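(* Fix $K\ge2$ and assume $\frac nK\ge2$. Let $\Theta=\Theta(n,K,a,b)$ be the homogeneous balanced SBM parameter class with $K$ communities, within-community edge probability $a/n$, across-community edge probability $b/n$, and balanced labelings in $\Sigma$. For each $\theta\in\Theta$, let $\sigma_\theta\in\Sigma$ be a representative ground-truth labeling, and let $\mathbb P_\theta$ and $\mathbb E_\theta$ denote the probability and expectation under the SBM law corresponding to $\theta$ (including the internal randomness of the mechanism). Then $$\inf_{\mathcal M:(\varepsilon,\delta)\text{-node-DP}}\ \sup_{\theta\in\Theta}\mathbb P_\theta\bigl(r(\sigma_\theta,\mathcal M(A))>0\bigr)\ge\left[\frac{1-(1+e^\varepsilon)\delta}{1+e^{2\varepsilon}}\right]_+$$ and $$\inf_{\mathcal M:(\varepsilon,\delta)\text{-node-DP}}\ \sup_{\theta\in\Theta}\mathbb E_\theta r(\sigma_\theta,\mathcal M(A))\ge\frac1n\left[\frac{1-(1+e^\varepsilon)\delta}{1+e^{2\varepsilon}}\right]_+,$$ where $[x]_+=\max\{x,0\}$ and the infima are over all $(\varepsilon,\delta)$-node-DP randomized mechanisms $\mathcal M:\mathcal G_n\to[K]^n$.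
   Context: $n,K$ are integers with $K\mid n$; $\varepsilon,\delta\ge0$. $\mathcal G_n$ is the set of undirected graphs on $[n]=\{1,\dots,n\}$, identified with symmetric zero-diagonal adjacency matrices $A\in\{0,1\}^{n\times n}$. $\Sigma=\{\sigma:[n]\to[K]:|\sigma^{-1}(k)|=n/K\ \forall k\in[K]\}$. The SBM with ground truth $\sigma\in\Sigma$ draws the upper-triangular entries of $A$ independently with $\mathbb P(A_{ij}=1)=a/n$ if $\sigma(i)=\sigma(j)$ and $b/n$ otherwise; the class $\Theta$ consists of the SBMs obtained as $\sigma$ ranges over $\Sigma$. For $\sigma,\tau\in[K]^n$: $h(\sigma,\tau)=|\{i:\sigma_i\ne\tau_i\}|$ and $r(\sigma,\tau)=\frac1n\min_{\pi\in\mathfrak S_K}h(\pi\circ\sigma,\tau)$, with $\mathfrak S_K$ the permutations of $[K]$. Two graphs are node-adjacent, $A\sim_vA'$, if they differ only on edges incident to a single vertex. A randomized mechanism $\mathcal M$ on $\mathcal G_n$ is $(\varepsilon,\delta)$-node-DP if $\mathbb P(\mathcal M(A)\in S)\le e^\varepsilon\mathbb P(\mathcal M(A')\in S)+\delta$ for all $A\sim_vA'$ and all measurable $S$. *)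

(* Defs.v *)
From HB Require Import structures.
From mathcomp Require Import all_boot all_order all_algebra all_fingroup.
From mathcomp Require Import all_classical all_reals all_analysis.

Set Implicit Arguments.
Unset Strict Implicit.
Unset Printing Implicit Defensive.

Import Order.TTheory GRing.Theory Num.Theory.

Local Open Scope ring_scope.

(* A_{ij} = 1 is encoded as [A i j = true]. *)
Definition is_adjacency n (A : 'M[bool]_n) : bool :=
  (A^T == A) && [forall i, ~~ A i i].

Record sgraph n := SGraph {
  adj :> 'M[bool]_n;
  _ : is_adjacency adj
}.

HB.instance Definition _ n := [isSub for @adj n].
HB.instance Definition _ n := [Finite of sgraph n by <:].

Definition node_adjacent n (A A' : sgraph n) : Prop :=
  exists v : 'I_n, forall i j : 'I_n, i != v -> j != v -> A i j = A' i j.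

Definition labeling n K := {ffun 'I_n -> 'I_K}.

Definition balanced n K : {set labeling n K} :=
  [set s : labeling n K |
    [forall k : 'I_K, #|[set i : 'I_n | s i == k]| == (n %/ K)%N]].

Definition hamming n K (s t : labeling n K) : nat :=
  #|[set i : 'I_n | s i != t i]|.

Definition relabel n K (p : 'S_K) (s : labeling n K) : labeling n K :=
  [ffun i => p (s i)].

Definition mismatch (R : realType) n K (s t : labeling n K) : R :=
  let p := [arg min_(q < 1%g : 'S_K) hamming (relabel q s) t] in
  n%:R^-1 * (hamming (relabel p s) t)%:R.

Definition edge_prob (R : realType) n K (a b : R) (s : labeling n K)
    (i j : 'I_n) : R :=
  if s i == s j then a / n%:R else b / n%:R.

(* Probability mass function of the SBM law on graphs: the entries above the
   diagonal are independent Bernoulli variables and determine the graph. *)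
Definition sbm (R : realType) n K (a b : R) (s : labeling n K)
    (A : sgraph n) : R :=
  \prod_(i < n) \prod_(j < n | (i < j)%N)
    bernoulli_pmf (edge_prob a b s i j) (A i j).

(* A randomized mechanism from graphs to [K]^n: as the output space is finite,
   the output distribution on each input is given by its mass function, and
   all subsets of the output space are measurable. *)
Record mechanism (R : realType) n K := Mechanism {
  mech_pmf :> sgraph n -> labeling n K -> R;
  mech_ge0 : forall A t, 0 <= mech_pmf A t;
  mech_sum1 : forall A, \sum_t mech_pmf A t = 1
}.

Definition mech_prob (R : realType) n K (M : mechanism R n K) (A : sgraph n)
    (S : {set labeling n K}) : R :=
  \sum_(t in S) M A t.

Definition node_dp (R : realType) n K (eps delta : R) (M : mechanism R n K) :
    Prop :=
  forall A A' : sgraph n, node_adjacent A A' ->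
  forall S : {set labeling n K},
    mech_prob M A S <= expR eps * mech_prob M A' S + delta.

(* Probability of the event [M(A) \in S], and expectation of [f (M(A))], when
   [A] has the SBM law with ground truth [s] and, given [A], [M(A)] is drawn
   with the internal randomness of [M]. *)
Definition sbm_prob (R : realType) n K (a b : R) (s : labeling n K)
    (M : mechanism R n K) (S : {set labeling n K}) : R :=
  \sum_(A : sgraph n) sbm a b s A * mech_prob M A S.

Definition sbm_expect (R : realType) n K (a b : R) (s : labeling n K)
    (M : mechanism R n K) (f : labeling n K -> R) : R :=
  \sum_(A : sgraph n) sbm a b s A * \sum_t M A t * f t.

(* Main.v *)
(* Two-point argument. Let s' be obtained from a balanced labeling s by swapping
   two vertices u and v of different communities. Permuting the vertices of a
   graph by the transposition (u v) carries the SBM law of s to that of s' and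
   changes only edges incident to u or v, that is, it amounts to two node
   changes. Hence P_s'(M(A) in S) <= e^(2 eps) P_s(M(A) in S) + (1 + e^eps) delta
   for every S. As n/K >= 2, s and s' differ by more than a relabeling, so exact
   recovery of s' is an error for s. Taking for S the exact recovery of s', the
   errors p, p' at s, s' satisfy 1 - p' <= e^(2 eps) p + (1 + e^eps) delta. The
   expectation bound follows since r takes values in (1/n) Z. *)
Require Import Defs.
From HB Require Import structures.
From mathcomp Require Import all_boot all_order all_algebra all_fingroup.
From mathcomp Require Import all_classical all_reals all_analysis.
From mathcomp Require Import lra.

Set Implicit Arguments.
Unset Strict Implicit.
Unset Printing Implicit Defensive.

Import Order.TTheory GRing.Theory Num.Theory.

Local Open Scope classical_set_scope.
Local Open Scope ring_scope.

(** * Simple graphs: vertex permutations and changes at one vertex *)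

Section SimpleGraphs.
Variable n : nat.
Implicit Types (A B : sgraph n) (p : 'S_n).

Lemma adj_sym A i j : A i j = A j i.
Proof.
case: A => M /= /andP[/eqP MT _].
by rewrite -[in LHS]MT mxE.
Qed.

Lemma adj_irr A i : A i i = false.
Proof.
case: A => M /= /andP[_ /forallP /(_ i)].
exact: negbTE.
Qed.

Lemma sgraph_eq A B : (forall i j : 'I_n, (i < j)%N -> A i j = B i j) -> A = B.
Proof.
move=> AB; apply: val_inj; apply/matrixP => i j /=.
case: (ltngtP i j) => [/AB //|/AB ji|/val_inj ->]; last by rewrite !adj_irr.
by rewrite adj_sym ji adj_sym.
Qed.

(** Only the values of [e] above the diagonal are read, so [e] may be arbitrary and every family of
    bits over pairs [i < j] gives a graph. *)
Definition upper_graph_mx (e : 'I_n -> 'I_n -> bool) : 'M[bool]_n :=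
  \matrix_(i, j) if (i < j)%N then e i j else (j < i)%N && e j i.

Lemma upper_graph_subproof e : is_adjacency (upper_graph_mx e).
Proof.
apply/andP; split; last by apply/forallP => i; rewrite mxE ltnn.
by apply/eqP/matrixP => i j; rewrite !mxE; case: ltngtP.
Qed.

Definition upper_graph e : sgraph n := SGraph (upper_graph_subproof e).

Lemma upper_graphE e (i j : 'I_n) : (i < j)%N -> upper_graph e i j = e i j.
Proof. by move=> ij; rewrite /= mxE ij. Qed.

Lemma upper_graph_symE e (i j : 'I_n) :
  (forall i, e i i = false) -> (forall i j, e i j = e j i) ->
  upper_graph e i j = e i j.
Proof.
move=> irr sym; rewrite /= mxE.
have [//|_|/val_inj ->] := ltngtP i j; first exact: sym.
by rewrite irr.
Qed.

Definition perm_graph p A : sgraph n := upper_graph (fun i j => A (p i) (p j)).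

Lemma perm_graphE p A i j : perm_graph p A i j = A (p i) (p j).
Proof.
by apply: upper_graph_symE => *; [exact: adj_irr|exact: adj_sym].
Qed.

Lemma perm_graphK p : cancel (perm_graph p) (perm_graph p^-1).
Proof.
move=> A; apply: sgraph_eq => i j _.
by rewrite !perm_graphE !permKV.
Qed.

Lemma perm_graph_bij p : bijective (perm_graph p).
Proof.
exists (perm_graph p^-1); first exact: perm_graphK.
by move=> A; have := perm_graphK p^-1 A; rewrite invgK.
Qed.

(** The midpoint of a two-step path of node changes from [A] to [B]. *)
Definition splice v A B : sgraph n :=
  upper_graph (fun i j => if (i == v) || (j == v) then B i j else A i j).

Lemma spliceE v A B i j :
  splice v A B i j = if (i == v) || (j == v) then B i j else A i j.
Proof.
apply: upper_graph_symE => [k|k l]; first by rewrite !adj_irr if_same.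
by rewrite orbC (adj_sym A) (adj_sym B).
Qed.

Lemma splice_adjl v A B : node_adjacent A (splice v A B).
Proof. by exists v => i j /negbTE iv /negbTE jv; rewrite spliceE iv jv. Qed.

Lemma splice_adjr u v A B :
  (forall i j, i \notin [:: u; v] -> j \notin [:: u; v] -> A i j = B i j) ->
  node_adjacent (splice u A B) B.
Proof.
move=> AB; exists v => i j iv jv; rewrite spliceE.
case: eqVneq => //= iu; case: eqVneq => //= ju.
by apply: AB; rewrite !inE negb_or ?iu ?iv ?ju ?jv.
Qed.

End SimpleGraphs.

(** * Products over pairs of vertices [i < j] *)

Section OrderedPairs.
Variables (R : comNzRingType) (n : nat).
Implicit Types (p : 'S_n) (x : 'I_n * 'I_n).

Let ordered x := (x.1 < x.2)%N.

Let sort_pair x := if (x.1 < x.2)%N then x else (x.2, x.1).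

Let perm_pair p x := sort_pair (p x.1, p x.2).

Let perm_pair_ordered p x : ordered x -> ordered (perm_pair p x).
Proof.
rewrite /perm_pair /sort_pair /ordered /= => lt12.
case: ifPn => //=; rewrite -leqNgt leq_eqVlt =>
  /orP[/eqP/val_inj/perm_inj e|//].
by rewrite e ltnn in lt12.
Qed.

Let perm_pairK p x : ordered x -> perm_pair p^-1 (perm_pair p x) = x.
Proof.
case: x => i j; rewrite /perm_pair /sort_pair /ordered /= => ij.
by case: (p i < p j)%N; rewrite /= !permK ?ij // ltnNge ltnW.
Qed.

(** A permutation may reverse a pair; sorting the image gives a bijection of the ordered pairs, and
    the symmetry of [g] absorbs the reversal. *)
Lemma prod_ordered_perm p (g : 'I_n -> 'I_n -> R) :
  (forall i j, g i j = g j i) ->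
  \prod_(i < n) \prod_(j < n | (i < j)%N) g (p i) (p j) =
  \prod_(i < n) \prod_(j < n | (i < j)%N) g i j.
Proof.
move=> g_sym; rewrite !(pair_big_dep xpredT) /=.
rewrite [RHS](reindex_onto (perm_pair p) (perm_pair p^-1)) /=; last first.
  by move=> x x_ord; have := perm_pairK p^-1 x_ord; rewrite invgK.
apply: eq_big => [x|x _]; last first.
  by rewrite /perm_pair /sort_pair /=; case: ifP => //= _; rewrite g_sym.
apply/idP/andP => [x_ord|[px_ord /eqP <-]]; last exact: perm_pair_ordered.
by split; [exact: perm_pair_ordered|rewrite perm_pairK].
Qed.

(** Distributivity turns the product of sums into a sum over families of bits, which correspond to
    graphs. It yields the total mass of the SBM law. *)
Lemma sum_sgraph_prod (F : 'I_n -> 'I_n -> bool -> R) :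
  \sum_(A : sgraph n) \prod_(i < n) \prod_(j < n | (i < j)%N) F i j (A i j) =
  \prod_(i < n) \prod_(j < n | (i < j)%N) (F i j true + F i j false).
Proof.
rewrite [RHS](pair_big_dep xpredT) /=.
under [RHS]eq_bigr do rewrite -(big_bool _ (F _ _)).
rewrite (big_distr_big_dep false) /=.
(* Entries off the ordered pairs are set to [false], the default value that [pfamily] imposes
   outside its support. *)
pose entries (A : sgraph n) : {ffun 'I_n * 'I_n -> bool} :=
  [ffun x => ordered x && A x.1 x.2].
pose graph (f : {ffun 'I_n * 'I_n -> bool}) := upper_graph (fun i j => f (i, j)).
have graphK f :
    f \in pfamily false ordered (fun=> xpredT) -> entries (graph f) = f.
  move=> /pfamilyP[/fintype.subsetP f_supp _]; apply/ffunP => -[i j].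
  rewrite ffunE /ordered /=; case: ltnP => [ij|/leq_gtF ij].
    by rewrite upper_graphE.
  apply/esym/negbTE; apply/negP => fij.
  by have := f_supp (i, j); rewrite !unfold_in /= /ordered /= fij ij => /(_ isT).
rewrite (reindex_onto entries graph) //=.
apply: eq_big => [A|A _].
  apply/esym/andP; split.
    apply/pfamilyP; split=> //; apply/fintype.subsetP => x.
    by rewrite !unfold_in /= ffunE /ordered; case: (_ < _)%N.
  apply/eqP; apply: sgraph_eq => i j ij.
  by rewrite upper_graphE // ffunE /ordered /= ij.
rewrite (pair_big_dep xpredT) /=; apply: eq_bigr => x x_ord.
by rewrite ffunE /ordered x_ord.
Qed.

End OrderedPairs.

(** * The SBM law and private mechanisms under a vertex swap *)

Section StochasticBlockModel.
Variables (R : realType) (n K : nat) (a b : R).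
Implicit Types (s t : labeling n K) (p : 'S_n)
  (A B : sgraph n) (S : {set labeling n K}).

Definition permute_vertices p s : labeling n K := [ffun i => s (p i)].

Lemma balanced_permute p s :
  (permute_vertices p s \in balanced n K) = (s \in balanced n K).
Proof.
rewrite !inE; apply: eq_forallb => k; congr (_ == _).
rewrite -(card_preimset [set i | s i == k] (@perm_inj _ p)).
by apply: eq_card => i; rewrite !inE ffunE.
Qed.

Lemma sbm_permute p s A :
  sbm a b (permute_vertices p s) (perm_graph p A) = sbm a b s A.
Proof.
pose g i j := bernoulli_pmf (edge_prob a b s i j) (A i j).
rewrite /sbm -[RHS](prod_ordered_perm p (g := g)); last first.
  by move=> i j; rewrite /g adj_sym /edge_prob eq_sym.
apply: eq_bigr => i _; apply: eq_bigr => j _.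
by rewrite /g perm_graphE /edge_prob !ffunE.
Qed.

Lemma sbm_sum1 s : \sum_A sbm a b s A = 1.
Proof.
rewrite /sbm (sum_sgraph_prod (fun i j => bernoulli_pmf (edge_prob a b s i j))).
by apply: big1 => i _; apply: big1 => j _; rewrite /= addrC subrK.
Qed.

Hypotheses (n_gt0 : (0 < n)%N) (ha : 0 <= a <= n%:R) (hb : 0 <= b <= n%:R).

Lemma sbm_ge0 s A : 0 <= sbm a b s A.
Proof.
have prob (c : R) : 0 <= c <= n%:R -> 0 <= c / n%:R <= 1.
  move=> /andP[c0 cn]; apply/andP; split; first exact: divr_ge0.
  by rewrite ler_pdivrMr ?mul1r // ltr0n.
apply: prodr_ge0 => i _; apply: prodr_ge0 => j _.
by apply: bernoulli_pmf_ge0; rewrite /edge_prob; case: ifP => _; exact: prob.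
Qed.

Variables (eps delta : R) (M : mechanism R n K).

Lemma mech_prob_ge0 A S : 0 <= mech_prob M A S.
Proof. by apply: sumr_ge0 => t _; exact: mech_ge0. Qed.

Lemma sbm_prob_ge0 s S : 0 <= sbm_prob a b s M S.
Proof.
by apply: sumr_ge0 => A _; rewrite mulr_ge0 ?sbm_ge0 ?mech_prob_ge0.
Qed.

Lemma sbm_probC s S : sbm_prob a b s M S + sbm_prob a b s M (~: S)%SET = 1.
Proof.
rewrite /sbm_prob -big_split /= -[RHS](sbm_sum1 s); apply: eq_bigr => A _.
rewrite -mulrDr -[RHS]mulr1 -(mech_sum1 M A) (bigID (mem S)) /=.
by congr (_ * (_ + _)); apply: eq_bigl => t; rewrite inE.
Qed.

Lemma sbm_prob_subset s (S T : {set labeling n K}) :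
  S \subset T -> sbm_prob a b s M S <= sbm_prob a b s M T.
Proof.
move=> ST; apply: ler_sum => A _; apply: ler_wpM2l; first exact: sbm_ge0.
rewrite /mech_prob [leRHS](big_setID S) /= (finset.setIidPr ST) lerDl.
by apply: sumr_ge0 => t _; exact: mech_ge0.
Qed.

Hypothesis M_dp : node_dp eps delta M.

(** Privacy is applied twice through [splice u A B]; the [delta] of the second step is multiplied by
    the [expR eps] of the first. *)
Lemma node_dp2 (u v : 'I_n) A B S :
  (forall i j, i \notin [:: u; v] -> j \notin [:: u; v] -> A i j = B i j) ->
  mech_prob M A S <=
    expR (2 * eps) * mech_prob M B S + (1 + expR eps) * delta.
Proof.
move=> AB.
have h1 := M_dp (splice_adjl u A B) S.
have h2 := M_dp (splice_adjr AB) S.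
have := ler_wpM2l (expR_ge0 eps) h2.
by rewrite (expRM_natl 2) expr2; lra.
Qed.

(* The law under the swapped labeling is the image of the original law under
   the swap of u and v, which only affects edges at u or v: this couples the two
   laws so that the graphs are two node changes apart. *)
Lemma sbm_prob_swap (u v : 'I_n) s S :
  sbm_prob a b (permute_vertices (tperm u v) s) M S <=
    expR (2 * eps) * sbm_prob a b s M S + (1 + expR eps) * delta.
Proof.
rewrite /sbm_prob (reindex _ (onW_bij _ (perm_graph_bij (tperm u v)))) /=.
set d := _ * delta.
(* As the law has mass 1, [d] is its own mean under [s], which reduces the claim to one inequality
   per graph. *)
rewrite -[d]mul1r -[X in X * d](sbm_sum1 s) mulr_sumr mulr_suml -big_split /=.
apply: ler_sum => A _; rewrite sbm_permute mulrCA -mulrDr.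
apply: ler_wpM2l; first exact: sbm_ge0.
apply: (node_dp2 (u := u) (v := v)) => i j; rewrite !inE !negb_or.
move=> /andP[iu iv] /andP[ju jv].
by rewrite perm_graphE !tpermD // eq_sym.
Qed.

End StochasticBlockModel.

(** * Relabelings and the mismatch loss *)

Lemma relabelM n K (p q : 'S_K) (s : labeling n K) :
  relabel q (relabel p s) = relabel (p * q)%g s.
Proof. by apply/ffunP => i; rewrite !ffunE permM. Qed.

Section Mismatch.
Variables (R : realType) (n K : nat).
Implicit Types s t : labeling n K.

Lemma mismatch_ge0 s t : 0 <= mismatch R s t.
Proof. by rewrite mulr_ge0 ?invr_ge0. Qed.

Lemma mismatch_gt0_ge s t : 0 < mismatch R s t -> n%:R^-1 <= mismatch R s t.
Proof.
rewrite /mismatch; case: (hamming _ _) => [|k]; first by rewrite mulr0 ltxx.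
by move=> _; rewrite ler_peMr ?invr_ge0 // ler1n.
Qed.

Lemma mismatch_eq0 s t : (0 < n)%N ->
  ~~ (0 < mismatch R s t) -> exists q : 'S_K, relabel q s = t.
Proof.
move=> n_gt0; rewrite /mismatch; set q := [arg min_(_ < _) _] => h.
exists q; apply/ffunP => i; apply/eqP; apply: contraNT h => neq.
rewrite mulr_gt0 ?invr_gt0 ?ltr0n //.
by apply/card_gt0P; exists i; rewrite inE.
Qed.

(** Markov's inequality at level [1/n], the least positive value of the loss. The law has ground
    truth [s0] and the loss uses [s], since the representative may differ from the labeling that
    defines the law. *)
Lemma sbm_expect_mismatch_ge a b s0 s (M : mechanism R n K) :
  (0 < n)%N -> 0 <= a <= n%:R -> 0 <= b <= n%:R ->
  n%:R^-1 * sbm_prob a b s0 M [set t | 0 < mismatch R s t]%SET <=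
  sbm_expect a b s0 M (mismatch R s).
Proof.
move=> n_gt0 ha hb; rewrite mulr_sumr; apply: ler_sum => A _.
rewrite mulrCA; apply: ler_wpM2l; first exact: sbm_ge0.
rewrite mulr_sumr [leRHS](bigID (mem [set t | 0 < mismatch R s t]%SET)) /=.
rewrite ler_wpDr //.
  by apply: sumr_ge0 => t _; rewrite mulr_ge0 ?mech_ge0 ?mismatch_ge0.
apply: ler_sum => t; rewrite inE => /mismatch_gt0_ge h.
by rewrite mulrC ler_wpM2l // mech_ge0.
Qed.

End Mismatch.

(** * Balanced labelings that no relabeling identifies *)

Lemma balanced_nonempty n K : (K %| n)%N -> exists s, s \in balanced n K.
Proof.
move=> /dvdnP[q ->]; have [->|K_gt0] := posnP K.
  exists [ffun i : 'I_(q * 0) => cast_ord (muln0 q) i].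
  by rewrite inE; apply/forallP => -[].
have card_prod_ord : #|{: 'I_q * 'I_K}| = (q * K)%N.
  by rewrite card_prod !card_ord.
(* Vertices are identified with pairs in ['I_q * 'I_K] and labeled by the second component, so each
   class is a copy of ['I_q]. *)
pose label (i : 'I_(q * K)) := (enum_val (cast_ord (esym card_prod_ord) i)).2.
pose vertex k (j : 'I_q) := cast_ord card_prod_ord (enum_rank (j, k)).
exists [ffun i => label i]; rewrite inE; apply/forallP => k.
have -> : ([set i | [ffun i => label i] i == k] = vertex k @: 'I_q)%SET.
  apply/setP => i; rewrite inE ffunE; apply/eqP/imsetP => [<-|[j _ ->]].
    exists (enum_val (cast_ord (esym card_prod_ord) i)).1 => //.
    by rewrite /vertex -surjective_pairing enum_valK cast_ordKV.
  by rewrite /label /vertex cast_ordK enum_rankK.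
rewrite card_imset ?card_ord ?mulnK // => j1 j2.
by move=> /cast_ord_inj/enum_rank_inj[].
Qed.

(* Swap u, v from different communities: a third vertex w in the community of u
   has company u before the swap but not after it. *)
Lemma exists_swap n K : (2 <= K)%N -> (K %| n)%N -> (2 <= n %/ K)%N ->
  exists (s : labeling n K) (u v : 'I_n), s \in balanced n K /\
    forall q q' : 'S_K,
      relabel q s <> relabel q' (permute_vertices (tperm u v) s).
Proof.
case: K => [|[|K]] // _ dvdKn two_le.
have [s s_bal] := balanced_nonempty dvdKn.
have card_class k : #|[set i | s i == k]%SET| = (n %/ K.+2)%N.
  by apply/eqP; move: s_bal; rewrite inE => /forallP.
have /card_gt1P[u [w []]] : (1 < #|[set i | s i == ord0]%SET|)%N.
  by rewrite card_class.
rewrite !inE => /eqP su /eqP sw uw.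
have /card_gt0P[v] : (0 < #|[set i | s i == ord_max]%SET|)%N.
  by rewrite card_class ltnW.
rewrite inE => /eqP sv.
have vw : v != w by apply/eqP => vw; rewrite -vw sv in sw.
exists s, u, v; split=> // q q' /ffunP e.
have := e u; rewrite !ffunE tpermL su sv.
have := e w; rewrite !ffunE tpermD // sw => -> /perm_inj.
by [].
Qed.

(** * The lower bound for a fixed mechanism, then for the infimum *)

Section Bound.
Variables (R : realType) (n K : nat) (a b eps delta : R).
Hypotheses (hK : (2 <= K)%N) (hKn : (K %| n)%N) (hnK : (2 <= n %/ K)%N).
Hypotheses (ha : 0 <= a <= n%:R) (hb : 0 <= b <= n%:R).
Variable sigma : labeling n K -> labeling n K.
Hypothesis hsigma : forall theta : labeling n K, theta \in balanced n K ->
  exists p : 'S_K, sigma theta = relabel p theta.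

Lemma exists_hard_labeling (M : mechanism R n K) : node_dp eps delta M ->
  exists2 theta, theta \in balanced n K &
    Num.max ((1 - (1 + expR eps) * delta) / (1 + expR (2 * eps))) 0 <=
    sbm_prob a b theta M [set t | 0 < mismatch R (sigma theta) t]%SET.
Proof.
move=> M_dp; set bound := Num.max _ _.
have n_gt0 : (0 < n)%N.
  by rewrite lt0n; apply: contraL hnK => /eqP->; rewrite div0n.
have [s [u [v [s_bal s_neq]]]] := exists_swap hK hKn hnK.
set s' := permute_vertices (tperm u v) s in s_neq.
have s'_bal : s' \in balanced n K by rewrite balanced_permute.
pose err th := [set t : labeling n K | 0 < mismatch R (sigma th) t]%SET.
have disj : (~: err s' \subset err s)%SET.
  apply/fintype.subsetP => t; rewrite !inE => /(mismatch_eq0 n_gt0)[q' t's].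
  apply/negPn/negP => /(mismatch_eq0 n_gt0)[q ts].
  have [p sp] := hsigma s_bal; have [p' sp'] := hsigma s'_bal.
  by apply: (s_neq (p * q)%g (p' * q')%g); rewrite -!relabelM -sp -sp' ts.
have swap := sbm_prob_swap n_gt0 ha hb M_dp u v s (~: err s').
have sub := sbm_prob_subset n_gt0 ha hb M s disj.
have total := sbm_probC a b M s' (err s').
have [ok|small] := leP bound (sbm_prob a b s M (err s)); first by exists s.
exists s' => //; rewrite leNgt; apply/negP => small'.
have e_gt0 : 0 < expR (2 * eps) by exact: expR_gt0.
have := small; have := small'; rewrite /bound.
(* If the truncation at 0 is active, nonnegativity of the error probability suffices. *)
case: (leP ((1 - (1 + expR eps) * delta) / (1 + expR (2 * eps))) 0).
  by move=> _ _; rewrite ltNge sbm_prob_ge0.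
move=> _ lt1 lt2.
have pos : 0 < 1 + expR (2 * eps) by rewrite addr_gt0.
set c := _ / _ in lt1 lt2.
have cE : c * (1 + expR (2 * eps)) = 1 - (1 + expR eps) * delta.
  by rewrite divfK // gt_eqF.
(* If both errors were below [c], the error at [s'] plus [expR (2 * eps)] times the error at [s]
   would be below [c * (1 + expR (2 * eps))], against the swap inequality. *)
move: swap sub total lt1 lt2 cE; rewrite -/s' -/(err s) -/(err s').
nra.
Qed.

End Bound.

(* [theta] ranges over the SBMs of the class, each given by its ground truth;
   [sigma theta] is an arbitrary representative of that ground truth up to
   a permutation of the labels. *)
Theorem theorem5 (R : realType) (n K : nat) (a b eps delta : R)
    (hK : (2 <= K)%N) (hKn : (K %| n)%N) (hnK : (2 <= n %/ K)%N)
    (ha : 0 <= a <= n%:R) (hb : 0 <= b <= n%:R)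
    (heps : 0 <= eps) (hdelta : 0 <= delta)
    (sigma : labeling n K -> labeling n K)
    (hsigma : forall theta : labeling n K, theta \in balanced n K ->
       exists p : 'S_K, sigma theta = relabel p theta) :
  let bound : R :=
    Num.max ((1 - (1 + expR eps) * delta) / (1 + expR (2 * eps))) 0 in
  (bound%:E <=
     ereal_inf [set
       ereal_sup [set
         (sbm_prob a b theta M
            [set t : labeling n K | 0 < mismatch R (sigma theta) t]%SET)%:E
         | theta in [set` balanced n K]]
       | M in [set M : mechanism R n K | node_dp eps delta M]])%E
  /\
  ((n%:R^-1 * bound)%:E <=
     ereal_inf [set
       ereal_sup [set
         (sbm_expect a b theta M (fun t => mismatch R (sigma theta) t))%:E
         | theta in [set` balanced n K]]
       | M in [set M : mechanism R n K | node_dp eps delta M]])%E.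
Proof.
move=> bound.
have n_gt0 : (0 < n)%N.
  by rewrite lt0n; apply: contraL hnK => /eqP->; rewrite div0n.
(* The hard labeling may depend on [M]: each mechanism is bounded separately, and its supremum
   dominates the value at that labeling. *)
split; apply/ereal_infP => _ [M M_dp <-];
  have [theta theta_bal hard] :=
    exists_hard_labeling hK hKn hnK ha hb hsigma M_dp;
  apply: le_trans (ereal_sup_ubound (ex_intro2 _ _ theta theta_bal erefl));
  rewrite lee_fin //.
apply: le_trans (sbm_expect_mismatch_ge _ _ _ n_gt0 ha hb).
by rewrite ler_wpM2l ?invr_ge0.
Qed.
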